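(* Let $\mu$ be a non-negative Borel measure on $[0,\infty)$, put $M(t)=\int_{[0,t]}\mu(ds)$ for $t\ge 0$, and suppose $M(t)<\infty$ for all $t\ge 0$, $\lim_{t\to\infty}M(t)=\infty$ and $M\in \mathrm{RV}_\infty(\theta)$ for some $\theta\ge 0$. Let $f\in \mathrm{RV}_\infty(\beta)$ with $\beta\in[0,1)$; when $\beta=0$ suppose in addition that $f$ is asymptotically increasing and $\lim_{x\to\infty}f(x)=\infty$. Let $H(t)=\int_0^t h(s)\,ds$ satisfy $H\in C((0,\infty);(0,\infty))$ and $$\lim_{t\to\infty}\frac{M(t)\int_0^t f(H(s))\,ds}{H(t)}=0.$$ Let $\xi>0$. Then the continuous solution $x$ of $$x'(t)=\int_{[0,t]}\mu(ds)\,f(x(t-s))+h(t),\quad t>0;\qquad x(0)=\xi,$$ obeys $\lim_{t\to\infty}x(t)/H(t)=1$.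
   Context: $\mathrm{RV}_\infty(\rho)$ ($\rho\in\mathbb{R}$) denotes the class of measurable functions $g$, positive for all sufficiently large arguments, with $\lim_{x\to\infty}g(\lambda x)/g(x)=\lambda^\rho$ for every $\lambda>0$. The function $f:[0,\infty)\to[0,\infty)$ is continuous and positive on $(0,\infty)$. Write $a(x)\sim b(x)$ if $a(x)/b(x)\to1$ as $x\to\infty$. ''$f$ asymptotically increasing'' means there is $\phi\in C^1((0,\infty);(0,\infty))\cap C([0,\infty);(0,\infty))$ with $\phi'(x)>0$ for all $x>0$ and $f(x)\sim\phi(x)$ as $x\to\infty$. The function $h:[0,\infty)\to\mathbb{R}$ is locally integrable (not assumed positive), and the equation is understood in its equivalent integral form $x(t)=\xi+\int_0^t M(t-s)f(x(s))\,ds+H(t)$, $t\ge 0$. Existence and uniqueness of the continuous positive solution on $[0,\infty)$ is part of the standing framework and is taken as given. *)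

(* Defs.v *)
From HB Require Import structures.
From mathcomp Require Import all_boot all_order all_algebra.
From mathcomp Require Import all_classical all_reals all_analysis.
Import Order.TTheory GRing.Theory Num.Theory.
Import numFieldNormedType.Exports.

Set Implicit Arguments.
Unset Strict Implicit.
Unset Printing Implicit Defensive.

Local Open Scope classical_set_scope.
Local Open Scope ring_scope.

(* Functions on [0, +oo) are encoded as functions R -> R whose values on the
   negative half-line play no role. *)

Definition RV_infty (R : realType) (rho : R) (g : R -> R) : Prop :=
  [/\ measurable_fun (`[0, +oo[ : set R) g,
      (\forall x \near +oo, 0 < g x) &
      forall lambda : R, 0 < lambda ->
        g (lambda * x) / g x @[x --> +oo] --> lambda `^ rho].

Definition asymp_equiv (R : realType) (a b : R -> R) : Prop :=
  a x / b x @[x --> +oo] --> (1 : R).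

(* Only one-sided continuity is required at 0; phi is C^1 on (0, +oo) only. *)
Definition asymp_increasing (R : realType) (f : R -> R) : Prop :=
  exists phi : R -> R,
    [/\ {within `[0, +oo[, continuous phi}
          /\ (forall x : R, 0 <= x -> 0 < phi x),
        (forall x : R, 0 < x -> derivable phi x 1)
          /\ (forall x : R, 0 < x -> {for x, continuous (derive1 phi)}),
        forall x : R, 0 < x -> 0 < derive1 phi x &
        asymp_equiv f phi].

(* M(t) = mu [0, t] ; [fine] is harmless when mu [0, t] is finite. *)
Definition cumul (R : realType)
    (mu : {measure set (measurableTypeR R) -> \bar R}) (t : R) : R :=
  fine (mu `[0, t]%classic).

(* The library's [locally_integrable] only covers open domains. *)
Definition locally_integrable_pos (R : realType) (h : R -> R) : Prop :=
  forall T : R, 0 <= T ->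
    (@lebesgue_measure R).-integrable `[0, T] (EFin \o h).

Definition primitive0 (R : realType) (h : R -> R) (t : R) : R :=
  \int[@lebesgue_measure R]_(s in `[0, t]) h s.

(* Positive continuous solution on [0, +oo) of
     x'(t) = \int_[0,t] f (x (t - s)) mu(ds) + h t,   x 0 = xi,
   understood in integrated form; the initial condition is the case t = 0. *)
Definition volterra_solution (R : realType)
    (mu : {measure set (measurableTypeR R) -> \bar R})
    (f h : R -> R) (xi : R) (x : R -> R) : Prop :=
  [/\ {within `[0, +oo[, continuous x},
      (forall t : R, 0 <= t -> 0 < x t) &
      forall t : R, 0 <= t ->
        x t = xi
              + \int[@lebesgue_measure R]_(s in `[0, t])
                  (cumul mu (t - s) * f (x s))
              + primitive0 h t].

(* Main.v *)
(* Write H for the primitive of h, F(t) for the integral of f(H) over [0, t] and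
   q = x / H, so that x >= H. Regular variation of index beta < 1 makes f(u)/u
   almost decreasing at infinity: f y <= C (y/z) f z for y >= z >= X.
   The domination hypothesis forces M/H -> 0, hence H -> +oo, and if q <= K on
   [T, t] the equation gives
     q(t) <= 1 + xi/H(t) + A M(t)/H(t) + C K M(t) F(t)/H(t).
   The coefficient of K tends to 0, so q is bounded, and then the same inequality
   with K a global bound gives limsup q <= 1. *)

Require Import Defs.
From HB Require Import structures.
From mathcomp Require Import all_boot all_order all_algebra.
From mathcomp Require Import all_classical all_reals all_analysis.
From mathcomp Require Import measurable_realfun.
From mathcomp Require Import ring lra.
Import Order.TTheory GRing.Theory Num.Theory.
Import numFieldNormedType.Exports.
Local Open Scope classical_set_scope.
Local Open Scope ring_scope.

(** * Regular variation: uniform bounds by a category argument *)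

(** If every complement were dense, these open dense sets would have a common point by Baire's
    theorem, and no [E n] would cover it. A complement that is not dense misses a ball. *)
Lemma Baire_cover {R : realType} {E : (set R)^nat} :
  (forall n, closed (E n)) -> (forall x : R, exists n, E n x) ->
  exists n (x r : R), 0 < r /\ ball x r `<=` E n.
Proof.
move=> Ecl Ecov.
have [i ndense] : exists i, ~ dense (~` E i).
  apply: contrapT => /forallNP Edense.
  have /Baire/(_ setT) : forall i, open (~` E i) /\ dense (~` E i).
    by move=> i; split; [exact: closed_openC|exact: contrapT (Edense i)].
  case; [by exists 0|exact: openT|move=> x [_ xE]].
  by have [n /(xE n I)] := Ecov x.
have [V [[x /open_nbhs_nbhs/nbhs_ballP[r r0 xrV]] VE0]] := denseNE ndense.
exists i, x, r; split=> // y /xrV Vy; apply: contrapT => nEy.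
by have : set0 y by rewrite -VE0.
Qed.

(* The sets E n of those v for which f (e^v y) / f y stays in [1/(n+1), n+1] for all
   y >= n+1 are closed and cover R, so one of them contains an interval; dividing
   out its centre turns it into an interval around 1. *)
Lemma RV_quotient_bounded {R : realType} {rho : R} {f : R -> R} :
  RV_infty rho f ->
  (forall u : R, 0 < u -> {for u, continuous f}) ->
  (forall u : R, 0 < u -> 0 < f u) ->
  exists r C X : R, [/\ 1 < r, 0 < C, 0 < X &
    forall l y, 1 <= l <= r -> X <= y -> f (l * y) <= C * f y].
Proof.
move=> [_ _ f_rv] f_cont f_gt0.
pose E (n : nat) : set R := \bigcap_(y in [set y : R | n.+1%:R <= y])
  [set v | f (expR v * y) <= n.+1%:R * f y /\
           f y <= n.+1%:R * f (expR v * y)].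
have n0 n : 0 < n.+1%:R :> R by [].
have Eclosed n : closed (E n).
  apply: closed_bigI => y /= ny.
  have y0 : 0 < y by exact: lt_le_trans ny.
  have cfe : continuous (fun v => f (expR v * y)).
    move=> v; apply: (@continuous_comp _ _ _ (fun v => expR v * y) f).
      apply: continuousM; [exact: continuous_expR|exact: cvg_cst].
    by apply: f_cont; rewrite mulr_gt0// expR_gt0.
  have -> : [set v | f (expR v * y) <= n.+1%:R * f y /\
                     f y <= n.+1%:R * f (expR v * y)] =
      (fun v => f (expR v * y)) @^-1` [set z | z <= n.+1%:R * f y] `&`
      (fun v => f (expR v * y)) @^-1` [set z | f y / n.+1%:R <= z].
    by apply/seteqP; split=> v /=; rewrite ler_pdivrMr// [_ * n.+1%:R]mulrC.
  by apply: closedI; apply: preimage_closed => [v _|];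
    [exact: cfe|exact: closed_le|exact: cfe|exact: closed_ge].
have Ecover v : exists n, E n v.
  have l0 := expR_gt0 v.
  set L := expR v `^ rho; have L0 : 0 < L by exact: powR_gt0.
  have := f_rv _ l0; rewrite -/L => fL.
  have [X [_ HX]] : \forall y \near +oo,
      L / 2 < f (expR v * y) / f y /\ f (expR v * y) / f y < L + 1.
    near=> y; split; near: y.
      by apply: (cvgr_gt _ fL); lra.
    by apply: (cvgr_lt _ fL); lra.
  (* [n.+1] exceeds the threshold [X], the bound [L + 1] on the ratio and the bound [2 / L] on its
     inverse; the [1] makes [y] positive. *)
  exists (Num.truncn (Num.max (Num.max X 1) (Num.max (L + 1) (2 / L)))) => y /=.
  set n := Num.truncn _ => ny.
  have : Num.max (Num.max X 1) (Num.max (L + 1) (2 / L)) < n.+1%:R.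
    exact: Num.Theory.truncnS_gt.
  rewrite !gt_max => /andP[/andP[Xn n1]] /andP[Ln nL].
  have y0 : 0 < y by lra.
  have fy := f_gt0 _ y0.
  have [|h0 h0'] := HX y; first lra.
  have h1 : L / 2 * f y < f (expR v * y) by rewrite -ltr_pdivlMr.
  have h2 : f (expR v * y) < (L + 1) * f y by rewrite -ltr_pdivrMr.
  split.
    by rewrite (le_trans (ltW h2))// ler_pM2r// ltW.
  have {}h1 : f y <= 2 / L * f (expR v * y).
    by rewrite mulrAC ler_pdivlMr//; lra.
  rewrite (le_trans h1)// ler_pM2r// ?ltW// f_gt0// mulr_gt0//.
have [n [v [r [r0 vrE]]]] := Baire_cover Eclosed Ecover.
(* Both [ln l * y]-type shifts are read at the base point [expR (- v) * y], which is at least [n.+1]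
   by the choice of the threshold: the exponents [ln l + v] and [v] each cost a factor [n.+1],
   whence the square. Halving [r] keeps [ln l + v] inside the open ball. *)
exists (expR (r / 2)), (n.+1%:R * n.+1%:R), (n.+1%:R * expR v).
split; rewrite ?mulr_gt0 ?expR_gt0//; first by rewrite expR_gt1; lra.
move=> l y /andP[l1 lr] Xy.
have l0 : 0 < l by lra.
have zn : n.+1%:R <= expR (- v) * y.
  by rewrite expRN mulrC ler_pdivlMr// expR_gt0.
have vy : expR v * (expR (- v) * y) = y by rewrite mulrA -expRD subrr expR0 mul1r.
have [|_] := vrE v _ _ zn; first exact: ballxx.
have [|+ _] := vrE (ln l + v) _ _ zn.
  rewrite /ball/= opprD addrCA subrr addr0 normrN ger0_norm ?ln_ge0//.
  rewrite (@le_lt_trans _ _ (r / 2))//; last lra.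
  by rewrite -[leRHS]expRK ler_ln ?posrE// expR_gt0.
rewrite expRD lnK ?posrE// -mulrA vy => h1 h2.
by rewrite (le_trans h1)// -mulrA ler_pM2l.
Unshelve. all: by end_near. Qed.

(* Potter's bound, with exponent 1 in place of rho + epsilon. *)
Lemma RV_sublinear_ratio {R : realType} {rho : R} {f : R -> R} :
  rho < 1 -> RV_infty rho f ->
  (forall u : R, 0 < u -> {for u, continuous f}) ->
  (forall u : R, 0 < u -> 0 < f u) ->
  exists C X : R, [/\ 0 < C, 0 < X &
    forall y z, X <= z -> z <= y -> f y <= C * (y / z) * f z].
Proof.
move=> rho1 f_rv f_cont f_gt0.
have [r [C [X0 [r1 C0 X00 Cf]]]] := RV_quotient_bounded f_rv f_cont f_gt0.
have r0 : 0 < r by lra.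
(* The limit of this ratio is [r] to the power [rho], which is below [r] because [rho < 1 < r]. *)
have [X1 [_ HX1]] : \forall y \near +oo, f (r * y) / f y < r.
  have [_ _ /(_ _ r0) fr] := f_rv.
  apply: (cvgr_lt _ fr); rewrite /powR gt_eqF// -[ltRHS]lnK ?posrE//.
  by rewrite ltr_expR gtr_pMl ?ln_gt0.
have [X [X0X X1X]] : exists X, X0 < X /\ X1 < X.
  by exists (Num.max X0 X1 + 1); split; rewrite ltr_pwDr// le_max lexx ?orbT.
exists C, X; split=> //; first lra.
have small y z : X <= z -> z <= y -> y <= r * z -> f y <= C * (y / z) * f z.
  move=> Xz zy yr; have z0 : 0 < z by lra.
  have yz : 1 <= y / z by rewrite ler_pdivlMr ?mul1r.
  have := Cf (y / z) z; rewrite divfK ?gt_eqF// yz ler_pdivrMr// => h.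
  rewrite (le_trans (h yr _))//; first lra.
  by rewrite ler_pM2r ?f_gt0// ler_peMr// ltW.
(* Induction on the number of scalings by [r]: passing from [y / r] to [y] multiplies [f] by at most
   [r], exactly the growth of [y / z], so [C] is paid only once, in the last partial scale. *)
have step n y z : X <= z -> z <= y -> y <= r ^+ n.+1 * z ->
    f y <= C * (y / z) * f z.
  elim: n y => [|n IH] y Xz zy yr; first by apply: small; rewrite // -[r]expr1.
  have [|/ltW zyr] := leP y (r * z); first exact: small.
  have z0 : 0 < z by lra.
  have zy' : z <= y / r by rewrite ler_pdivlMr// mulrC.
  have {}IH : f (y / r) <= C * (y / r / z) * f z.
    by apply: IH; rewrite // ler_pdivrMr// mulrAC -exprSr.
  have := HX1 (y / r); rewrite [r * _]mulrC divfK ?gt_eqF//.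
  rewrite ltr_pdivrMr; last by apply: f_gt0; lra.
  move=> /(_ _)/ltW h; apply: (le_trans (h _)); first lra.
  rewrite -(ler_pM2l r0) in IH; apply: (le_trans IH).
  by rewrite le_eqVlt; apply/orP; left; apply/eqP; field; rewrite !gt_eqF.
move=> y z Xz zy; have z0 : 0 < z by lra.
have [n yn] : exists n, y / z <= r ^+ n.+1.
  exists (Num.truncn (ln (y / z) / ln r)).
  have yz : 0 < y / z by rewrite divr_gt0//; lra.
  rewrite -ler_ln ?posrE ?exprn_gt0// lnXn// -mulr_natl -ler_pdivrMr ?ln_gt0//.
  by rewrite ltW// truncnS_gt.
by apply: (step n); rewrite // -ler_pdivrMr.
Qed.

(** * Measurability and convolution with a monotone kernel *)

(** The point 0, where continuity is not assumed, is split off: any function is measurable on a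
    singleton. *)
Lemma measurable_fun_continuous_gt0 {R : realType} {g : R -> R} :
  (forall u : R, 0 < u -> {for u, continuous g}) ->
  measurable_fun (`[0, +oo[ : set R) g.
Proof.
move=> gc; have -> : `[0, +oo[%classic = ([set 0] `|` `]0, +oo[%classic) :> set R.
  by apply/seteqP; split=> u /=; rewrite !in_itv/= !andbT;
    [rewrite le_eqVlt => /orP[/eqP->|]; [left|right]|case=> [->|/ltW]].
apply/measurable_funU => //; split; first exact: measurable_fun_set1.
apply: open_continuous_measurable_fun; first exact: interval_open.
by move=> u; rewrite inE/= in_itv/= andbT; exact: gc.
Qed.

Lemma cumul_ge0 {R : realType} (mu : {measure set (measurableTypeR R) -> \bar R})
  (t : R) : 0 <= cumul mu t.
Proof. exact: fine_ge0. Qed.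

Lemma cumul_le {R : realType} {mu : {measure set (measurableTypeR R) -> \bar R}}
    {s t : R} :
  (forall t : R, 0 <= t -> (mu `[0%R, t]%classic < +oo)%E) ->
  0 <= s -> s <= t -> cumul mu s <= cumul mu t.
Proof.
move=> M_fin s0 st; have t0 : 0 <= t by exact: le_trans st.
apply: fine_le; rewrite ?ge0_fin_numE ?M_fin//.
by apply: le_measure; rewrite ?inE//; apply: subset_itvl; rewrite bnd_simp.
Qed.

(** Pointwise, [k (t - s) <= k t]. The same bound makes the left integrand integrable. *)
Lemma Rintegral_convolution_le {R : realType} {k g : R -> R} {t : R} :
  0 <= t -> measurable_fun (`[0, +oo[ : set R) k ->
  (forall s, 0 <= s -> 0 <= k s) ->
  (forall s, 0 <= s -> s <= t -> k s <= k t) ->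
  (forall s, 0 <= s -> s <= t -> 0 <= g s) ->
  (@lebesgue_measure R).-integrable `[0, t] (EFin \o g) ->
  \int[@lebesgue_measure R]_(s in `[0, t]) (k (t - s) * g s) <=
  k t * \int[@lebesgue_measure R]_(s in `[0, t]) g s.
Proof.
move=> t0 mk k0 kt g0 ig.
have kle s : s \in `[0, t] -> 0 <= k (t - s) * g s <= k t * g s.
  rewrite in_itv/= => /andP[s0 st].
  rewrite mulr_ge0 ?k0 ?g0 ?subr_ge0//= ler_wpM2r ?g0// kt ?subr_ge0//.
  by rewrite lerBlDr lerDl.
have ikg : (@lebesgue_measure R).-integrable `[0, t] (EFin \o (fun s => k t * g s)).
  by apply: eq_integrable (integrableZl _ (k t) ig) => //; exact: measurable_itv.
rewrite -RintegralZl//; apply: le_Rintegral => //; last first.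
  by move=> s /kle/andP[].
apply: le_integrable ikg => //.
  apply/measurable_EFinP/measurable_funM; last first.
    by apply/measurable_EFinP; exact: measurable_int ig.
  apply: (measurable_comp _ _ mk) => //.
    by move=> _ [s /= + <-]; rewrite !in_itv/= andbT subr_ge0 => /andP[].
  exact: measurable_funB.
move=> s /kle /andP[k1 k2].
by rewrite /= lee_fin !ger0_norm// (le_trans k1).
Qed.

(** * A priori bound by absorption *)

(** At a maximum point [c] of [q] on [[T, t]] the value [q c] is itself an admissible [K]. If [c] is
    large, this gives [q c <= a + q c / 2], hence [q c <= 2 * a], uniformly in [t]. *)
Lemma sublinear_bootstrap {R : realType} {q e d : R -> R} {T a : R} :
  (forall t, T <= t -> {within `[T, t], continuous q}) ->
  (\forall t \near +oo, e t <= a) -> (\forall t \near +oo, d t <= 2^-1) ->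
  (forall t K, T <= t -> 0 <= K -> (forall s, T <= s -> s <= t -> q s <= K) ->
     q t <= e t + d t * K) ->
  exists2 K, 0 <= K & forall t, T <= t -> q t <= K.
Proof.
move=> qc ea d2 qK.
have [S [TS HS]] : exists S, T <= S /\ forall t, S <= t -> e t <= a /\ d t <= 2^-1.
  have [S0 [_ HS]] : \forall t \near +oo, e t <= a /\ d t <= 2^-1.
    by near=> t; split; near: t.
  exists (Num.max T (S0 + 1)); rewrite le_max lexx; split=> // t.
  by rewrite ge_max => /andP[_ St]; apply: HS; lra.
have [c1 _ c1S] := EVT_max TS (qc _ TS).
(* [q c1] handles maxima located in [[T, S]], [2 * a] the later ones; 0 covers a negative maximum,
   to which [qK] does not apply. *)
exists (Num.max (q c1) (Num.max 0 (2 * a))); first by rewrite !le_max lexx orbT.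
move=> t Tt; have [c + ct] := EVT_max Tt (qc _ Tt).
rewrite in_itv/= => /andP[Tc ct'].
apply: (@le_trans _ _ (q c)); first by apply: ct; rewrite in_itv/= Tt lexx.
have [cS|Sc] := leP c S.
  by rewrite !le_max c1S// in_itv/= Tc.
rewrite !le_max; have [qc0|qc0] := leP (q c) 0; first by rewrite orbT.
apply/orP; right; apply/orP; right.
have [ec dc] := HS _ (ltW Sc).
have h : q c <= e c + d c * q c.
  apply: qK => //; first exact: ltW.
  by move=> s Ts sc; apply: ct; rewrite in_itv/= Ts (le_trans sc).
have : d c * q c <= 2^-1 * q c by rewrite ler_wpM2r// ltW.
lra.
Unshelve. all: by end_near. Qed.

(** * Consequences of the domination hypothesis *)

(** Convergence to 0 in the extended reals makes the product finite for large [s]. As [M s] and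
    [H s] are positive there, an infinite integral would make it infinite; smaller intervals follow
    by monotonicity. *)
Lemma domination_integrable {R : realType} {M F H : R -> R} :
  (forall u : R, 0 < u -> {for u, continuous F}) ->
  (forall u : R, 0 <= u -> 0 <= F u) ->
  M t @[t --> +oo] --> +oo ->
  (forall t : R, 0 < t -> 0 < H t) ->
  ((M t)%:E * (\int[@lebesgue_measure R]_(s in `[0%R, t]) (F s)%:E)
     * ((H t)^-1)%:E)%E @[t --> +oo] --> 0%E ->
  forall t, (@lebesgue_measure R).-integrable `[0, t] (EFin \o F).
Proof.
move=> Fc F0 My H0 dom t.
have mF s : measurable_fun (`[0, s]%classic : set R) (EFin \o F).
  apply/measurable_EFinP.
  apply: measurable_funS (measurable_fun_continuous_gt0 Fc) => //.
  by apply: subset_itvl.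
apply/integrableP; split; first exact: mF.
have /fine_cvgP[fdom _] := dom.
have [s [s0 ts Ms fs]] : exists s, [/\ 0 < s, t <= s, 0 < M s &
    ((M s)%:E * (\int[@lebesgue_measure R]_(s in `[0%R, s]) (F s)%:E)
     * ((H s)^-1)%:E)%E \is a fin_num].
  apply: (@filter_ex _ (pinfty_nbhs R)).
  near=> s; split; near: s => //.
  - exact: nbhs_pinfty_gt (num_real _).
  - exact: nbhs_pinfty_ge (num_real _).
  - by move/cvgryPgt : My; exact.
rewrite (@le_lt_trans _ _ (\int[@lebesgue_measure R]_(s in `[0%R, s]) (F s)%:E)%E)//.
  apply: (@le_trans _ _ (\int[@lebesgue_measure R]_(s in `[0%R, s]) `|(F s)%:E|)%E).
    apply: ge0_subset_integral => //.
      by apply/measurableT_comp => //; exact: mF.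
    by apply: subset_itvl; rewrite bnd_simp.
  rewrite le_eqVlt; apply/orP; left; apply/eqP; apply: eq_integral => u.
  by rewrite inE/= in_itv/= => /andP[u0 _]; rewrite ger0_norm ?F0.
have : (0 <= \int[@lebesgue_measure R]_(s in `[0%R, s]) (F s)%:E)%E.
  by apply: integral_ge0 => u /=; rewrite in_itv/= lee_fin => /andP[/F0].
case: (integral _ _ _) fs => [r _ _| |//]; first by rewrite ltry.
by rewrite gt0_muley ?lte_fin// gt0_mulye// lte_fin invr_gt0 H0.
Unshelve. all: by end_near. Qed.

Lemma domination_cvg {R : realType} {M F H : R -> R} :
  (forall u : R, 0 < u -> {for u, continuous F}) ->
  (forall u : R, 0 <= u -> 0 <= F u) ->
  (forall u : R, 0 < u -> 0 < F u) ->
  M t @[t --> +oo] --> +oo ->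
  (forall t : R, 0 < t -> 0 < H t) ->
  ((M t)%:E * (\int[@lebesgue_measure R]_(s in `[0%R, t]) (F s)%:E)
     * ((H t)^-1)%:E)%E @[t --> +oo] --> 0%E ->
  M t * (\int[@lebesgue_measure R]_(s in `[0, t]) F s) / H t
    @[t --> +oo] --> (0 : R) /\
  M t / H t @[t --> +oo] --> (0 : R).
Proof.
move=> Fc F0 Fgt0 My H0 dom.
have iF := domination_integrable Fc F0 My H0 dom.
set G := fun t => \int[@lebesgue_measure R]_(s in `[0, t]) F s.
have GE t : (\int[@lebesgue_measure R]_(s in `[0%R, t]) (F s)%:E)%E = (G t)%:E.
  by rewrite /G fineK//; exact: integrable_fin_num.
have dG : M t * G t / H t @[t --> +oo] --> (0 : R).
  have /fine_cvgP[_] := dom; apply: cvg_trans; apply: near_eq_cvg.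
  by near=> t; rewrite /= GE.
split=> //.
(* A positive lower bound on [G] turns the first limit into the second, since then
   [M / H <= c^-1 * (M * G / H)]. The interval [[1, 2]] avoids 0 and has length 1, so the minimum of
   [F] on it serves as [c]. *)
have [c c0 cG] : exists2 c, 0 < c & forall t, 2 <= t -> c <= G t.
  have Fc12 : {within `[1, 2], continuous F}.
    apply/subspace_continuousP => u /=; rewrite in_itv/= => /andP[u1 _].
    by apply: cvg_within_filter; apply: Fc; lra.
  have [|v v12 vmin] := EVT_min _ Fc12; first lra.
  have Fv : 0 < F v by apply: Fgt0; move: v12; rewrite in_itv/= => /andP[]; lra.
  exists (F v) => //.
  move=> t t2; rewrite -lee_fin -GE.
  apply: (@le_trans _ _ (\int[@lebesgue_measure R]_(s in `[1%R, 2%R]) (F s)%:E)%E); last first.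
    apply: ge0_subset_integral => //.
    - exact: measurable_int (iF t).
    - by move=> u /=; rewrite in_itv/= lee_fin => /andP[/F0].
    - by apply: subset_itv; rewrite bnd_simp//; lra.
  apply: (@le_trans _ _ (\int[@lebesgue_measure R]_(s in `[1%R, 2%R]) (cst (F v)%:E s))%E).
    have mu12 : @lebesgue_measure R `[1, 2]%classic = 1%E.
      rewrite lebesgue_measure_itv/= lte_fin ltrDr ltr01 -EFinD; congr EFin; lra.
    rewrite integral_cst// -[leLHS]mule1 -mu12.
    by apply: lee_wpmul2l => //; rewrite lee_fin ltW.
  apply: ge0_le_integral => //.
  - by move=> u _; rewrite /cst lee_fin ltW.
  - apply: measurable_funS (measurable_int _ (iF 2)) => //.
    by apply: subset_itvr; rewrite bnd_simp; lra.
have cdG : c^-1 * (M t * G t / H t) @[t --> +oo] --> (0 : R).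
  by rewrite -[X in _ --> X](mulr0 c^-1); apply: cvgMr.
apply: (squeeze_cvgr _ (cvg_cst (0 : R)) cdG).
near=> t.
have M0 : 0 < M t by near: t; move/cvgryPgt : My; exact.
have t2 : 2 <= t by near: t; exact: nbhs_pinfty_ge (num_real _).
have Ht : 0 < H t by apply: H0; lra.
rewrite divr_ge0 ?(ltW M0) ?(ltW Ht)//= mulrA ler_pM2r ?invr_gt0//.
by rewrite mulrCA ler_pMr// mulrC ler_pdivlMr// mul1r cG.
Unshelve. all: by end_near. Qed.

(** * Comparison of the solution with the primitive of the forcing term *)

Lemma continuous_comp_integrable {R : realType} {f x : R -> R} {t : R} :
  {within `[0, +oo[, continuous x} ->
  (forall s : R, 0 <= s -> 0 < x s) ->
  (forall u : R, 0 < u -> {for u, continuous f}) ->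
  (@lebesgue_measure R).-integrable `[0, t] (EFin \o (f \o x)).
Proof.
move=> xc x0 fc; apply: continuous_compact_integrable.
  exact: segment_compact.
apply/subspace_continuousP => s /=; rewrite in_itv/= => /andP[s0 st].
have /subspace_continuousP xc0t : {within `[0, t], continuous x}.
  by apply: continuous_subspaceW xc; exact: subset_itvl.
have xs : x u @[u --> within `[0, t] (nbhs s)] --> x s.
  by apply: xc0t; rewrite /= in_itv/= s0.
by apply: cvg_comp xs _; exact/fc/x0.
Qed.

(** The other two terms of the equation are nonnegative. This gives the lower half of the limit and
    the ordering needed to compare [f (x s)] with [f (H s)]. *)
Lemma volterra_ge_primitive {R : realType}
    {mu : {measure set (measurableTypeR R) -> \bar R}} {f h x : R -> R} {xi : R} :
  (forall u : R, 0 <= u -> 0 <= f u) -> 0 <= xi ->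
  volterra_solution mu f h xi x ->
  forall t, 0 <= t -> primitive0 h t <= x t.
Proof.
move=> f0 xi0 [_ x0 xE] t t0; rewrite xE// lerDr addr_ge0//.
apply: Rintegral_ge0 => s /=; rewrite in_itv/= => /andP[s0 _].
by rewrite mulr_ge0 ?cumul_ge0// f0// ltW// x0.
Qed.

(** After [T], almost-monotonicity with [y = x s] and [z = H s] gives [f (x s) <= C * K * f (H s)];
    the last integral is then enlarged from []T, t]] to [[0, t]]. The part before [T] stays
    independent of [t] and [K]. *)
Lemma integral_comp_le {R : realType} {f x H : R -> R} {C X T t K : R} :
  0 <= C ->
  (forall y z, X <= z -> z <= y -> f y <= C * (y / z) * f z) ->
  0 <= T -> T <= t -> 0 <= K ->
  (forall s, 0 <= s -> 0 <= f (H s)) ->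
  (forall s, T <= s -> X <= H s) -> (forall s, T <= s -> H s <= x s) ->
  (forall s, T <= s -> s <= t -> x s / H s <= K) ->
  (@lebesgue_measure R).-integrable `[0, t] (EFin \o (f \o x)) ->
  (@lebesgue_measure R).-integrable `[0, t] (EFin \o (f \o H)) ->
  \int[@lebesgue_measure R]_(s in `[0, t]) f (x s) <=
  \int[@lebesgue_measure R]_(s in `[0, T]) f (x s) +
  C * K * \int[@lebesgue_measure R]_(s in `[0, t]) f (H s).
Proof.
move=> C0 fC T0 Tt K0 fH0 XH Hx xK ifx ifH.
have CK : 0 <= C * K by rewrite mulr_ge0.
have subTt : `]T, t]%classic `<=` (`[0, t]%classic : set R).
  by apply: subset_itvr; rewrite bnd_simp.
rewrite -lerBlDl Rintegral_itvB ?bnd_simp// -RintegralZl//.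
have iCfH : (@lebesgue_measure R).-integrable `[0, t] (EFin \o (fun s => C * K * f (H s))).
  by apply: eq_integrable (integrableZl _ (C * K) ifH) => //; exact: measurable_itv.
apply: (@le_trans _ _ (\int[@lebesgue_measure R]_(s in `]T, t]) (C * K * f (H s)))).
  apply: le_Rintegral => //.
  - exact: integrableS ifx.
  - exact: integrableS iCfH.
  move=> s; rewrite /= in_itv/= => /andP[/ltW Ts st].
  apply: (le_trans (fC _ _ (XH _ Ts) (Hx _ Ts))).
  rewrite ler_wpM2r ?fH0 ?(le_trans T0)// ler_wpM2l// xK//.
rewrite fine_le//.
- apply: integrable_fin_num => //; exact: integrableS iCfH.
- exact: integrable_fin_num.
apply: ge0_subset_integral => //.
- exact: measurable_int iCfH.
- by move=> s /=; rewrite in_itv/= => /andP[s0 _]; rewrite lee_fin mulr_ge0// fH0.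
Qed.

(* A Borel measure on [0, +oo) is a Borel measure on R that does not charge
   the negative half-line. The integral of f \o H is taken in the extended
   reals, so the limit condition entails its finiteness. *)
Theorem theorem6 (R : realType)
    (mu : {measure set (measurableTypeR R) -> \bar R})
    (theta beta xi : R) (f h x : R -> R)
    (mu_neg : mu `]-oo, 0[%classic = 0%E)
    (M_fin : forall t : R, 0 <= t -> (mu `[0%R, t]%classic < +oo)%E)
    (M_infty : cumul mu t @[t --> +oo] --> +oo)
    (theta_ge0 : 0 <= theta)
    (M_RV : RV_infty theta (cumul mu))
    (f_ge0 : forall u : R, 0 <= u -> 0 <= f u)
    (f_cont : forall u : R, 0 < u -> {for u, continuous f})
    (f_gt0 : forall u : R, 0 < u -> 0 < f u)
    (beta_ge0 : 0 <= beta) (beta_lt1 : beta < 1)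
    (f_RV : RV_infty beta f)
    (f_beta0 : beta = 0 ->
       asymp_increasing f /\ f u @[u --> +oo] --> +oo)
    (h_loc : locally_integrable_pos h)
    (H_cont : forall t : R, 0 < t -> {for t, continuous (primitive0 h)})
    (H_gt0 : forall t : R, 0 < t -> 0 < primitive0 h t)
    (H_dom :
       ((cumul mu t)%:E
          * (\int[@lebesgue_measure R]_(s in `[0%R, t])
               (f (primitive0 h s))%:E)
          * ((primitive0 h t)^-1)%:E)%E @[t --> +oo] --> 0%E)
    (xi_gt0 : 0 < xi)
    (x_sol : volterra_solution mu f h xi x) :
  x t / primitive0 h t @[t --> +oo] --> (1 : R).
Proof.
set H := primitive0 h; set M := cumul mu.
have H00 : H 0 = 0 by rewrite /H /primitive0 set_itv1 Rintegral_set1.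
have H_ge0 u : 0 <= u -> 0 <= H u.
  by rewrite le_eqVlt => /predU1P[<-|/H_gt0/ltW//]; rewrite H00.
have Fc u : 0 < u -> {for u, continuous (f \o H)}.
  by move=> u0; apply: continuous_comp; [exact: H_cont|exact/f_cont/H_gt0].
have F0 u : 0 <= u -> 0 <= (f \o H) u by move=> /H_ge0/f_ge0.
have Fgt0 u : 0 < u -> 0 < (f \o H) u by move=> /H_gt0/f_gt0.
have iF := domination_integrable Fc F0 M_infty H_gt0 H_dom.
have [d0 MH0] := domination_cvg Fc F0 Fgt0 M_infty H_gt0 H_dom.
have [xc x0 xE] := x_sol.
have [mM _ _] := M_RV.
have Hx t : 0 <= t -> H t <= x t.
  exact: (volterra_ge_primitive f_ge0 (ltW xi_gt0) x_sol).
have [C [X [C0 X0 fC]]] := RV_sublinear_ratio beta_lt1 f_RV f_cont f_gt0.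
(* Eventually [M t / H t <= 1], so [H] dominates [M] and exceeds [X]. *)
have [T [T0 XH]] : exists T, 0 < T /\ forall s, T <= s -> X <= H s.
  have [T0 [_ HT0]] : \forall t \near +oo, X <= H t.
    near=> t.
    have t0 : 0 < t by near: t; exact: nbhs_pinfty_gt.
    have : M t / H t <= 1 by near: t; apply: (cvgr_le _ MH0).
    rewrite ler_pdivrMr ?H_gt0// mul1r; apply: le_trans.
    by near: t; move/cvgryPge : M_infty; exact.
  exists (Num.max 1 (T0 + 1)); split; first by rewrite lt_max ltr01.
  by move=> s; rewrite ge_max => /andP[_ T0s]; apply: HT0; lra.
set G := fun t => \int[@lebesgue_measure R]_(s in `[0, t]) (f \o H) s.
set A := \int[@lebesgue_measure R]_(s in `[0, T]) f (x s).
pose e t := 1 + (xi / H t + A * (M t / H t)).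
pose d t := C * (M t * G t / H t).
have ifx t : (@lebesgue_measure R).-integrable `[0, t] (EFin \o (f \o x)).
  exact: continuous_comp_integrable.
have fx_ge0 s : 0 <= s -> 0 <= f (x s) by move=> /x0/ltW/f_ge0.
have key t K : T <= t -> 0 <= K ->
    (forall s, T <= s -> s <= t -> x s / H s <= K) ->
    x t / H t <= e t + d t * K.
  move=> Tt K0 xK; have t0 : 0 < t by lra.
  have Ht := H_gt0 _ t0.
  rewrite ler_pdivrMr// xE ?(ltW t0)// -/H -/M.
  have conv : \int[@lebesgue_measure R]_(s in `[0, t]) (M (t - s) * f (x s)) <=
      M t * \int[@lebesgue_measure R]_(s in `[0, t]) f (x s).
    apply: (Rintegral_convolution_le (ltW t0) mM _ _ _ (ifx t)).
    - by move=> s _; exact: cumul_ge0.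
    - by move=> s s0 st; exact: cumul_le.
    - by move=> s s0 _; exact: fx_ge0.
  have Ifx : \int[@lebesgue_measure R]_(s in `[0, t]) f (x s) <= A + C * K * G t.
    apply: (integral_comp_le (ltW C0) fC (ltW T0) Tt K0) => // s Ts.
    by apply: Hx; lra.
  have -> : (e t + d t * K) * H t = H t + xi + M t * (A + C * K * G t).
    by rewrite /e /d; field; rewrite gt_eqF.
  have := ler_wpM2l (cumul_ge0 mu t) Ifx; rewrite -/M; lra.
have e1 : e t @[t --> +oo] --> (1 : R).
  rewrite -[X in _ --> X]addr0; apply: cvgD; first exact: cvg_cst.
  rewrite -[X in _ --> X]addr0; apply: cvgD; last first.
    by rewrite -[X in _ --> X](mulr0 A); apply: cvgMr.
  (* Once [M t >= 1], the term [xi / H t] is at most [xi * (M t / H t)]. *)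
  have xMH : xi * (M t / H t) @[t --> +oo] --> (0 : R).
    by rewrite -[X in _ --> X](mulr0 xi); apply: cvgMr.
  apply: (squeeze_cvgr _ (cvg_cst (0 : R)) xMH); near=> t.
  have t0 : 0 < t by near: t; exact: nbhs_pinfty_gt.
  have M1 : 1 <= M t by near: t; move/cvgryPge : M_infty; exact.
  rewrite divr_ge0 ?(ltW xi_gt0) ?H_ge0 ?(ltW t0)//= mulrA ler_pM2r ?invr_gt0 ?H_gt0//.
  by rewrite ler_peMr// ltW.
have {}d0 : d t @[t --> +oo] --> (0 : R).
  by rewrite -[X in _ --> X](mulr0 C); apply: cvgMr.
(* Starting at [T > 0] avoids the zero of [H] at the origin. *)
have qc t : T <= t -> {within `[T, t], continuous (fun s => x s / H s)}.
  move=> Tt; apply/subspace_continuousP => s /=; rewrite in_itv/= => /andP[Ts st].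
  have s0 : 0 < s by lra.
  have /subspace_continuousP xcT : {within `[T, t], continuous x}.
    apply: continuous_subspaceW xc => u /=; rewrite !in_itv/= andbT => /andP[Tu _].
    by lra.
  apply: cvgM; first by apply: xcT; rewrite /= in_itv/= Ts.
  apply: cvg_within_filter; apply: cvgV; first by rewrite gt_eqF// H_gt0.
  exact: H_cont.
have [K K0 xK] : exists2 K, 0 <= K & forall t, T <= t -> x t / H t <= K.
  apply: (sublinear_bootstrap qc _ _ key).
    by apply: (cvgr_le _ e1 2); lra.
  by apply: (cvgr_le _ d0); rewrite invr_gt0.
(* Now [K] no longer depends on [t], so [key] squeezes the quotient between 1 and a bound tending to
   1. *)
have eK : e t + d t * K @[t --> +oo] --> (1 : R).
  rewrite -[X in _ --> X]addr0; apply: cvgD => //.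
  by rewrite -[X in _ --> X](mul0r K); apply: cvgMl.
apply: (squeeze_cvgr _ (cvg_cst (1 : R)) eK); near=> t.
have Tt : T <= t by near: t; exact: nbhs_pinfty_ge (num_real _).
rewrite key// => [|s Ts _]; last exact: xK.
by rewrite andbT ler_pdivlMr ?H_gt0 ?mul1r ?Hx//; lra.
Unshelve. all: by end_near. Qed.
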